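(* Let $\lambda$ be an infinite cardinal such that $\lambda = \lambda^{<\lambda}$. Then there exists an epi-universal group in the class $\mathcal{LN}_\lambda$; that is, there is a locally nilpotent group $G$ with $|G|\le \lambda$ such that every locally nilpotent group $H$ with $|H|\le\lambda$ is an epimorphic image of $G$.
   Context: A group $G$ is locally nilpotent if every finitely generated subgroup of $G$ is nilpotent. $\mathcal{LN}_\lambda$ denotes the class of all locally nilpotent groups of cardinality at most $\lambda$. A group $G\in\mathcal{LN}_\lambda$ is called epi-universal in $\mathcal{LN}_\lambda$ if for every $H\in\mathcal{LN}_\lambda$ there is a surjective group homomorphism $G\to H$. As usual $\lambda^{<\lambda}=\sup\{\lambda^{\mu}\mid \mu<\lambda \text{ a cardinal}\}$. *)

(* Defs.v *)
From HB Require Import structures.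
From mathcomp Require Import all_boot monoid.
From mathcomp Require Import boolp classical_sets functions cardinality.

Set Implicit Arguments.
Unset Strict Implicit.
Unset Printing Implicit Defensive.

Import Algebra.

Local Open Scope classical_set_scope.
Local Open Scope card_scope.
Local Open Scope group_scope.

Definition generated_subgroup (G : groupType) (S : set G) : set G :=
  smallest [set K : set G | group_closed [in K]] S.

(* The term of index [n] is gamma_(n+1)(K); the commutators and the subgroups
   they generate are computed in the ambient group [G]. *)
Fixpoint lower_central_series (G : groupType) (K : set G) (n : nat) : set G :=
  if n is m.+1 then
    generated_subgroup [set [~ x, y] | x in lower_central_series K m & y in K]
  else K.

Definition nilpotent_subgroup (G : groupType) (K : set G) : Prop :=
  exists n, lower_central_series K n = [set 1].

Definition locally_nilpotent (G : groupType) : Prop :=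
  forall S : set G, finite_set S -> nilpotent_subgroup (generated_subgroup S).

(* Cardinals are represented by types, compared through [#<=] and [#=]. *)

Definition card_lt (M L : Type) : Prop :=
  [set: M] #<= [set: L] /\ [set: M] #!= [set: L].

(* |S| = |K|^{<|L|}, i.e. |S| is the least upper bound, among cardinals, of the
   |K|^|M| = |M -> K| for |M| < |L|. *)
Definition is_weak_power (K L S : Type) : Prop :=
  (forall M : Type, card_lt M L -> [set: M -> K] #<= [set: S]) /\
  (forall U : Type, (forall M : Type, card_lt M L -> [set: M -> K] #<= [set: U]) ->
     [set: S] #<= [set: U]).

Definition in_LN (L : Type) (G : groupType) : Prop :=
  locally_nilpotent G /\ [set: G] #<= [set: L].

Definition epi_universal (L : Type) (G : groupType) : Prop :=
  in_LN L G /\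
  forall H : groupType, in_LN L H ->
    exists f : {multiplicative G -> H}, set_surj [set: G] [set: H] f.

(* Main.v *)
(** Enumerate a locally nilpotent group [H] of size at most [L] by a surjection
    [e : L -> H], and order [L] so that all proper initial segments are smaller
    than [L].  For [a] in [L], the nilpotency classes of the subgroups generated
    by [e a] and finitely many [e x], [x < a], form a function from the finite
    sequences in an initial segment to [nat].  As [L = L^{<L}], all these
    functions are dominated by a family indexed by [L], except that for a finite
    segment one dominates by constants.  A node [(a, l)] stands for [e a]
    together with a guess [l] of a dominating function; it is evaluated in
    [(H, e)] to [e a] if the guess is right and to [1] otherwise.  The subgroup
    generated by the nodes in the product of all the [(H, e)] has at most [L]
    elements and projects onto every [H].  It is locally nilpotent: in each
    coordinate, finitely many nodes generate a subgroup whose class is bounded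
    by the guess of the largest node that is right, hence by the maximum of
    finitely many numbers that do not depend on the coordinate. *)
Require Import Defs.
From HB Require Import structures.
From mathcomp Require Import all_boot monoid.
From mathcomp Require Import boolp classical_sets functions cardinality wochoice.

Set Implicit Arguments.
Unset Strict Implicit.
Unset Printing Implicit Defensive.

Import Algebra.

Local Open Scope classical_set_scope.
Local Open Scope card_scope.
Local Open Scope group_scope.

(** * Generated subgroups and lower central series under homomorphisms *)

Lemma generated_subgroup_closed (G : groupType) (S : set G) :
  group_closed [in generated_subgroup S].
Proof.
split; first by apply/mem_set => K [[K1 _] _]; exact/set_mem.
move=> x y /set_mem Sx /set_mem Sy; apply/mem_set => K KS.
by case: (KS.1) => _ Kdiv; apply/set_mem/Kdiv; apply/mem_set; [exact: Sx|exact: Sy].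
Qed.

Lemma generated_subgroup1 (G : groupType) (S : set G) : generated_subgroup S 1.
Proof. exact/set_mem/(generated_subgroup_closed S).1. Qed.

Lemma generated_subgroupM (G : groupType) (S : set G) (x y : G) :
  generated_subgroup S x -> generated_subgroup S y -> generated_subgroup S (x * y).
Proof.
move=> Sx Sy; apply/set_mem.
by apply: (group_closedM (generated_subgroup_closed S)); exact/mem_set.
Qed.

Lemma generated_subgroupV (G : groupType) (S : set G) (x : G) :
  generated_subgroup S x -> generated_subgroup S x^-1.
Proof.
move=> Sx; apply/set_mem.
by apply: (group_closedV (generated_subgroup_closed S)); exact/mem_set.
Qed.

Lemma generated_subgroup_min (G : groupType) (S T : set G) :
  S `<=` generated_subgroup T -> generated_subgroup S `<=` generated_subgroup T.
Proof. by apply: smallest_sub; exact: generated_subgroup_closed. Qed.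

Lemma generated_subgroupS (G : groupType) (S T : set G) :
  S `<=` T -> generated_subgroup S `<=` generated_subgroup T.
Proof. by move=> ST; apply: generated_subgroup_min; exact: sub_smallest. Qed.

Lemma generated_subgroup_trivial (G : groupType) (S : set G) :
  S `<=` [set 1] -> generated_subgroup S = [set 1].
Proof.
move=> S1; apply/seteqP; split; last by move=> _ ->; exact: generated_subgroup1.
apply: smallest_sub => //; split; first exact/mem_set.
by move=> x y /set_mem -> /set_mem ->; apply/mem_set; rewrite divgg.
Qed.

Lemma generated_subgroup_morph (G H : groupType) (f : UMagmaMorphism.type G H)
    (S : set G) (T : set H) :
  (forall x, S x -> generated_subgroup T (f x)) ->
  forall x, generated_subgroup S x -> generated_subgroup T (f x).
Proof.
move=> ST; apply: (@smallest_sub _ _ _ (f @^-1` generated_subgroup T)) => //; split.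
  by apply/mem_set; rewrite /= gmulf1; exact: generated_subgroup1.
move=> x y /set_mem/= Tx /set_mem/= Ty; apply/mem_set; rewrite /= gmulfF.
by apply: generated_subgroupM => //; exact: generated_subgroupV.
Qed.

Lemma lower_central_series_morph (G H : groupType) (f : UMagmaMorphism.type G H)
    (K : set G) (K' : set H) :
  (forall x, K x -> K' (f x)) ->
  forall n x, lower_central_series K n x -> lower_central_series K' n (f x).
Proof.
move=> KK'; elim=> [|n IHn] //=.
apply: generated_subgroup_morph => _ [x Kx [y Ky <-]].
by apply: sub_gen_smallest; exists (f x); [exact: IHn|exists (f y); [exact: KK'|rewrite gmulfR]].
Qed.

Lemma lower_central_series1 (G : groupType) (K : set G) (n : nat) :
  K 1 -> lower_central_series K n 1.
Proof. by case: n => [|n] // _; exact: generated_subgroup1. Qed.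

Lemma lower_central_series_trivial (G : groupType) (K : set G) (m n : nat) :
  (m <= n)%N -> lower_central_series K m = [set 1] ->
  lower_central_series K n = [set 1].
Proof.
move=> /subnK <- Km; elim: (n - m)%N => [|k IHk] //=.
apply: generated_subgroup_trivial.
by rewrite IHk => _ [_ -> [y _ <-]]; rewrite /= commgEl conj1g mulg1 invg1.
Qed.

Lemma lower_central_series_sub_trivial (G : groupType) (K K' : set G) (n : nat) :
  K 1 -> K `<=` K' -> lower_central_series K' n = [set 1] ->
  lower_central_series K n = [set 1].
Proof.
move=> K1 KK' K'n; apply/seteqP; split; last first.
  by move=> _ ->; exact: lower_central_series1.
(* The inclusion of [K] in [K'] is treated as the identity morphism. *)
by rewrite -K'n; exact: (@lower_central_series_morph G G idfun).
Qed.

(** * Words in signed generators and their values *)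

Definition word_eval (N : Type) (H : groupType) (f : N -> H)
    (w : seq (N * bool)) : H :=
  \prod_(x <- w) if x.2 then f x.1 else (f x.1)^-1.

Definition word_inv (N : Type) (w : seq (N * bool)) : seq (N * bool) :=
  rev [seq (x.1, ~~ x.2) | x <- w].

Lemma word_eval_nil (N : Type) (H : groupType) (f : N -> H) : word_eval f [::] = 1.
Proof. exact: big_nil. Qed.

Lemma word_eval_cat (N : Type) (H : groupType) (f : N -> H) (v w : seq (N * bool)) :
  word_eval f (v ++ w) = word_eval f v * word_eval f w.
Proof. exact: big_cat. Qed.

Lemma word_eval_inv (N : Type) (H : groupType) (f : N -> H) (w : seq (N * bool)) :
  word_eval f (word_inv w) = (word_eval f w)^-1.
Proof.
elim: w => [|[x b] w IHw]; first by rewrite !word_eval_nil invg1.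
rewrite /word_inv /= rev_cons -cats1 word_eval_cat IHw.
rewrite /word_eval big_seq1 big_cons invgM /=.
by case: b => //=; rewrite invgK.
Qed.

Lemma word_eval_generated (N : eqType) (H : groupType) (f : N -> H)
    (s : seq N) (w : seq (N * bool)) :
  {subset unzip1 w <= s} -> generated_subgroup (f @` [set` s]) (word_eval f w).
Proof.
elim: w => [|[x b] w IHw] ws; first by rewrite word_eval_nil; exact: generated_subgroup1.
rewrite /word_eval big_cons; apply: generated_subgroupM; last first.
  by apply: IHw => y wy; apply: ws; rewrite inE wy orbT.
have fx : generated_subgroup (f @` [set` s]) (f x).
  by apply: sub_gen_smallest; exists x => //=; apply: ws; rewrite inE eqxx.
by case: b {ws} => //=; exact: generated_subgroupV.
Qed.

(** * The subgroup of a large product generated by [N] *)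

Local Open Scope quotient_scope.

Section Residual.

Variables (N : choiceType) (P : forall H : groupType, (N -> H) -> Prop).

(* The group generated by [N] inside the product of all the pairs [(H, f)]
   selected by [P]; as a quotient of the set of words it is small although these
   pairs form a large type. *)
Definition word_equiv (v w : seq (N * bool)) : bool :=
  `[< forall (H : groupType) (f : N -> H), P f -> word_eval f v = word_eval f w >].

Lemma word_equiv_refl : reflexive word_equiv.
Proof. by move=> w; apply/asboolP. Qed.

Lemma word_equiv_sym : symmetric word_equiv.
Proof. by move=> v w; apply/asboolP/asboolP => vw H f /vw ->. Qed.

Lemma word_equiv_trans : transitive word_equiv.
Proof.
move=> v u w /asboolP uv /asboolP vw; apply/asboolP => H f Pf.
by rewrite uv // vw.
Qed.

Canonical word_equiv_rel :=
  EquivRel word_equiv word_equiv_refl word_equiv_sym word_equiv_trans.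

Definition residual := {eq_quot word_equiv_rel}.

HB.instance Definition _ := Choice.on residual.
HB.instance Definition _ := Quotient.on residual.

Definition residual_eval (H : groupType) (f : N -> H) (Pf : P f) (u : residual) : H :=
  word_eval f (repr u).

Lemma residual_eval_pi (H : groupType) (f : N -> H) (Pf : P f) (w : seq (N * bool)) :
  residual_eval Pf (\pi_residual w) = word_eval f w.
Proof.
have /eqmodP/asboolP : repr (\pi_residual w) = w %[mod residual] by rewrite reprK.
exact.
Qed.

(** The evaluations are the coordinates of the product, so they separate points; the group laws are
    then checked coordinatewise. *)
Lemma residual_ext (u v : residual) :
  (forall (H : groupType) (f : N -> H) (Pf : P f),
     residual_eval Pf u = residual_eval Pf v) ->
  u = v.
Proof.
move=> uv; rewrite -[u]reprK -[v]reprK; apply/eqmodP/asboolP => H f Pf.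
exact: uv.
Qed.

Definition residual_one : residual := \pi_residual [::].
Definition residual_mul (u v : residual) : residual :=
  \pi_residual (repr u ++ repr v).
Definition residual_inv (u : residual) : residual :=
  \pi_residual (word_inv (repr u)).

Lemma residual_eval1 (H : groupType) (f : N -> H) (Pf : P f) :
  residual_eval Pf residual_one = 1.
Proof. by rewrite residual_eval_pi word_eval_nil. Qed.

Lemma residual_evalM (H : groupType) (f : N -> H) (Pf : P f) :
  {morph residual_eval Pf : u v / residual_mul u v >-> u * v}.
Proof. by move=> u v; rewrite residual_eval_pi word_eval_cat. Qed.

Lemma residual_evalV (H : groupType) (f : N -> H) (Pf : P f) :
  {morph residual_eval Pf : u / residual_inv u >-> u^-1}.
Proof. by move=> u; rewrite residual_eval_pi word_eval_inv. Qed.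

Lemma residual_mulA : associative residual_mul.
Proof. by move=> u v w; apply: residual_ext => H f Pf; rewrite !residual_evalM mulgA. Qed.

Lemma residual_mul1g : left_id residual_one residual_mul.
Proof.
by move=> u; apply: residual_ext => H f Pf; rewrite residual_evalM residual_eval1 mul1g.
Qed.

Lemma residual_mulg1 : right_id residual_one residual_mul.
Proof.
by move=> u; apply: residual_ext => H f Pf; rewrite residual_evalM residual_eval1 mulg1.
Qed.

Lemma residual_mulVg : left_inverse residual_one residual_inv residual_mul.
Proof.
move=> u; apply: residual_ext => H f Pf.
by rewrite residual_evalM residual_evalV residual_eval1 mulVg.
Qed.

Lemma residual_mulgV : right_inverse residual_one residual_inv residual_mul.
Proof.
move=> u; apply: residual_ext => H f Pf.
by rewrite residual_evalM residual_evalV residual_eval1 mulgV.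
Qed.

HB.instance Definition _ := isGroup.Build residual
  residual_mulA residual_mul1g residual_mulg1 residual_mulVg residual_mulgV.

HB.instance Definition _ (H : groupType) (f : N -> H) (Pf : P f) :=
  isUMagmaMorphism.Build residual H (residual_eval Pf)
    (residual_eval1 Pf, residual_evalM Pf).

(** A finite subset lies in the subgroup generated by the finitely many letters of its
    representatives. Since [n] is uniform in [(H, f)], the term of index [n] vanishes in every
    coordinate. *)
Lemma residual_locally_nilpotent :
  (forall s : seq N, exists n, forall (H : groupType) (f : N -> H), P f ->
     lower_central_series (generated_subgroup (f @` [set` s])) n = [set 1]) ->
  locally_nilpotent residual.
Proof.
move=> nilP S /finite_seqP[t ->] {S}.
pose s := flatten [seq unzip1 (repr u) | u <- t].
have [n sn] := nilP s; exists n; apply/seteqP; split; last first.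
  by move=> _ ->; apply: lower_central_series1; exact: generated_subgroup1.
move=> u tu; apply: residual_ext => H f Pf; rewrite residual_eval1.
suff : lower_central_series (generated_subgroup (f @` [set` s])) n (residual_eval Pf u).
  by rewrite sn.
move: tu; apply: lower_central_series_morph.
apply: generated_subgroup_morph => v /= tv; apply: word_eval_generated => x vx.
by apply/flattenP; exists (unzip1 (repr v)) => //; exact: map_f.
Qed.

End Residual.

(** * Cardinal comparison through injections and surjections *)

Lemma card_leTTP (T U : Type) :
  [set: T] #<= [set: U] <-> exists f : T -> U, injective f.
Proof.
split=> [/card_leP[f]|[f f_inj]].
  exists (fun x => set_val (f (to_setT x))) => x y /val_inj.
  by move=> /(inj (mem_set I) (mem_set I)) /(congr1 set_val).
apply/asboolP/injfunPex.
exists (to_setT \o f \o set_val) => // x y _ _ /= /(congr1 set_val) /f_inj.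
exact: val_inj.
Qed.

Lemma left_inverse_of_injective (T U : Type) (x0 : T) (f : T -> U) :
  injective f -> exists g : U -> T, cancel f g.
Proof.
move=> f_inj; have /choice[g gP] : forall y, exists x, forall x', f x' = y -> x = x'.
  move=> y; have [[x <-]|noy] := pselect (exists x, f x = y).
    by exists x => x' /f_inj.
  by exists x0 => x' fx'; case: noy; exists x'.
by exists g => x; apply: gP.
Qed.

Lemma card_le_surj (T U : Type) (x0 : T) :
  [set: T] #<= [set: U] -> exists g : U -> T, forall x, exists y, g y = x.
Proof.
move=> /card_leTTP[f /(left_inverse_of_injective x0)[g gK]].
by exists g => x; exists (f x).
Qed.

Lemma surj_card_leT (T U : Type) (g : U -> T) :
  (forall x, exists y, g y = x) -> [set: T] #<= [set: U].
Proof.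
by move=> /choice[f fK]; apply/card_leTTP; exists f; exact: can_inj fK.
Qed.

Lemma infinite_setT_nat (L : Type) :
  ~ finite_set [set: L] -> exists f : nat -> L, injective f.
Proof. by move=> /infiniteP/card_leTTP. Qed.

Lemma card_lt_finite (M L : Type) :
  finite_set [set: M] -> ~ finite_set [set: L] -> card_lt M L.
Proof.
move=> Mfin Linf; split; last first.
  by apply/negP => /card_eqPle[_ LM]; apply: Linf; exact: card_le_finite LM Mfin.
case/finite_setP: Mfin => n Mn.
by rewrite (card_le_eql Mn); apply: card_le_trans (card_leT _) _; apply/infiniteP.
Qed.

(** * Orders whose initial segments are small *)

Lemma well_order_antisymmetric (L : eqType) (R : rel L) :
  well_order R -> antisymmetric R.
Proof.
move=> woR x y; apply: (@wo_chain_antisymmetric _ R predT) => // A _; exact: woR.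
Qed.

Lemma well_order_transitive (L : eqType) (R : rel L) :
  well_order R -> transitive R.
Proof.
move=> woR; have Ranti := well_order_antisymmetric woR.
(* Whichever of the three is least, antisymmetry reduces the goal to a known relation. *)
move=> y x z xy yz; have : wochoice.nonempty (mem [:: x; y; z]).
  by exists x; rewrite !inE eqxx.
move=> /woR[m [[+ mle] _]]; have [mx my mz] : [/\ R m x, R m y & R m z].
  by split; apply: mle; rewrite !inE eqxx ?orbT.
rewrite !inE => /or3P[] /eqP mE; move: mx my mz; rewrite mE // => mx my mz.
  by rewrite (Ranti x y) ?xy ?mx.
by rewrite (Ranti z y) ?yz ?my.
Qed.

(** If some segment of a well-order is as large as [L], take the least [m] with such a segment and
    pull the order back along an injection of [L] into the segment of [m]. A large segment of the
    new order would give a large one below some [f x] smaller than [m]. *)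
Lemma initial_strict_order (L : eqType) :
  exists lt : L -> L -> Prop,
    [/\ forall x y z, lt x y -> lt y z -> lt x z,
        forall x y, [\/ lt x y, x = y | lt y x] &
        forall x, ~ ([set: L] #<= [set y | lt y x])].
Proof.
have [R woR] := well_ordering_principle L.
have Ranti := well_order_antisymmetric woR.
have Rtrans := well_order_transitive woR.
have Rtotal x y : R x y \/ R y x.
  by apply/orP; apply: (@wo_chainW _ R predT) => // A _; exact: woR.
pose seg x := [set y | R y x && (y != x)].
have seg_trans x y z : seg y x -> seg z y -> seg z x.
  rewrite /seg /= => /andP[xy /eqP xNy] /andP[yz yNz]; rewrite (Rtrans y) //=.
  by apply/eqP => xz; apply: xNy; apply: Ranti; rewrite xy xz yz.
have seg_total x y : [\/ seg y x, x = y | seg x y].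
  have [->|xy] := eqVneq x y; first by constructor 2.
  by case: (Rtotal x y) => Rxy; [constructor 1|constructor 3];
    rewrite /seg /= Rxy // eq_sym.
have [[x0 segx0]|segN] := pselect (exists x, [set: L] #<= seg x); last first.
  exists (fun x y => seg y x); split=> // x Lx.
  by apply: segN; exists x.
have : wochoice.nonempty (fun x => `[< [set: L] #<= seg x >]).
  by exists x0; apply/asboolP.
move=> /woR[m [[/asboolP Lm mmin] _]].
have [f f_inj fm] : exists2 f : L -> L, injective f & forall x, seg m (f x).
  move/card_leP: Lm => [f].
  exists (fun x => set_val (f (to_setT x))); last by move=> x; apply: set_valP.
  by move=> x y /val_inj /(inj (mem_set I) (mem_set I)) /(congr1 set_val).
exists (fun x y => seg (f y) (f x)); split=> [x y z|x y|x Lx].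
- exact: seg_trans.
- by case: (seg_total (f x) (f y)) => [?|/f_inj|?]; [constructor 1|constructor 2|constructor 3].
have /andP[fxm /eqP] := fm x; apply; apply: Ranti; rewrite fxm mmin //.
apply/asboolP; apply: card_le_trans Lx _.
rewrite -(card_le_eql (inj_card_eq (f := f) _)); last by move=> ? ? _ _ /f_inj.
by apply: subset_card_le => _ [y /= fyx <-].
Qed.

Lemma strict_order_max (L : eqType) (lt : L -> L -> Prop) (s : seq L) :
  (forall x y z, lt x y -> lt y z -> lt x z) ->
  (forall x y, [\/ lt x y, x = y | lt y x]) ->
  s != [::] -> exists2 m, m \in s & forall x, x \in s -> x = m \/ lt x m.
Proof.
move=> lt_trans lt_total; elim: s => [//|x [|y s] IHs] _.
  by exists x; rewrite ?inE // => y; rewrite inE => /eqP; left.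
have [//|m ms mmax] := IHs.
case: (lt_total x m) => [xm|xm|mx].
- exists m; first by rewrite inE ms orbT.
  by move=> z; rewrite inE => /predU1P[->|/mmax]; [right|].
- exists m; first by rewrite inE ms orbT.
  by move=> z; rewrite inE => /predU1P[->|/mmax]; [left|].
exists x; first by rewrite inE eqxx.
move=> z; rewrite inE => /predU1P[->|/mmax[->|zm]]; [by left|by right|right].
exact: lt_trans mx.
Qed.

(** * Consequences of the equality of [L] with its weak power *)

Section WeakPower.

Variable L : Type.
Hypothesis infinite_L : ~ finite_set [set: L].
Hypothesis weak_power_L : is_weak_power L L L.

Let power_inj (M : Type) :
  card_lt M L -> exists f : (M -> L) -> L, injective f.
Proof. by move=> /weak_power_L.1/card_leTTP. Qed.

Lemma weak_power_prod : exists f : L * L -> L, injective f.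
Proof.
have [g g_inj] : exists f : (bool -> L) -> L, injective f.
  exact: power_inj (card_lt_finite (finite_finset (X := [set: bool])) infinite_L).
exists (fun x => g (fun b => if b then x.1 else x.2)) => -[x1 x2] [y1 y2].
by move=> /g_inj xy; congr pair; [move: (congr1 (@^~ true) xy)|move: (congr1 (@^~ false) xy)].
Qed.

Lemma weak_power_seq : exists f : seq L -> L, injective f.
Proof.
have [p p_inj] := weak_power_prod; have [n n_inj] := infinite_setT_nat infinite_L.
(* [n 0] is an arbitrary end marker; storing the length next to the folded code tells how often to
   unpair. *)
pose c := foldr (fun x y => p (x, y)) (n 0).
exists (fun s => p (n (size s), c s)) => s t /p_inj[/n_inj].
elim: s t => [|x s IHs] [|y t] //= [st] /p_inj[-> cst].
by rewrite (IHs t).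
Qed.

(** These are the words over the nodes; they bound the size of the universal group. *)
Lemma weak_power_words : [set: seq (L * L * bool)] #<= [set: L].
Proof.
have [p p_inj] := weak_power_prod; have [n n_inj] := infinite_setT_nat infinite_L.
have [c c_inj] := weak_power_seq; apply/card_leTTP.
exists (c \o map (fun x : L * L * bool => p (p x.1, n x.2))); apply: inj_comp c_inj _.
apply: inj_map => -[x b] [y d] /p_inj[/p_inj -> /n_inj].
by case: b d => -[].
Qed.

(* Iterated currying: functions of [seq M] split into functions of [M ^ n], and
   [L ^ (M ^ n.+1)] is [(L ^ (M ^ n)) ^ M]. *)
Lemma weak_power_fun_seq (M : Type) :
  card_lt nat L -> card_lt M L -> exists f : (seq M -> L) -> L, injective f.
Proof.
move=> /power_inj[k k_inj] /power_inj[p p_inj].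
pose fix enc (n : nat) (g : seq M -> L) {struct n} : L :=
  if n is n'.+1 then p (fun x => enc n' (g \o cons x)) else g [::].
have encP n g h s : enc n g = enc n h -> size s = n -> g s = h s.
  elim: n g h s => [|n IHn] g h [|x s] //= /p_inj gh [sn].
  by apply: (IHn (g \o cons x) (h \o cons x) s) => //; exact: (congr1 (@^~ x) gh).
(* The codes of [g] at all lengths form a function from [nat] to [L], which [k] encodes. *)
exists (fun g => k (enc^~ g)) => g h /k_inj gh; apply/funext => s.
by apply: (encP (size s)) => //; exact: (congr1 (@^~ (size s)) gh).
Qed.

End WeakPower.

(** [Q u n] will say that the class attached to [u] is at most [n]. For infinite [A], [L] is
    uncountable and all functions from [seq A] to [nat] have codes in [L]. For finite [A], [L] may
    be countable and these functions too many, but a list of all of [A] gives one bound for every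
    [u]. *)
Lemma dominating_family (L : eqType) (A : set L) :
  ~ finite_set [set: L] -> is_weak_power L L L -> ~ ([set: L] #<= A) ->
  exists b : L -> seq L -> nat, forall Q : seq L -> nat -> Prop,
    (forall u, exists n, Q u n) ->
    (forall u v n, {subset u <= v} -> Q v n -> Q u n) ->
    exists l, forall u, (forall x, x \in u -> A x) -> Q u (b l u).
Proof.
move=> infL powL LA; have [k k_inj] := infinite_setT_nat infL.
have ALlt : card_lt (set_type A) L.
  split; first by rewrite (card_le_eql (card_setT A)); exact: card_leT.
  apply/negP; rewrite (card_eql (card_setT A)) => /card_eqPle[_ ]; exact: LA.
have [Afin|Ainf] := pselect (finite_set A).
  have [b bK] := left_inverse_of_injective 0 k_inj.
  exists (fun l _ => b l) => Q Qex Qsub; have [s As] := (finite_seqP A).1 Afin.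
  (* [k n] is the index of the constant function [n]. *)
  have [n sn] := Qex s; exists (k n) => u uA; rewrite bK; apply: Qsub sn => x.
  by move=> /uA; rewrite As.
have natL : card_lt nat L.
  split; first exact/infiniteP.
  apply/negP => /card_eqPle[_ Lnat]; apply: LA; apply: card_le_trans Lnat _.
  exact/infiniteP.
have [f f_inj] := weak_power_fun_seq powL natL ALlt.
pose code (c : seq A -> nat) := f (k \o c).
have code_inj : injective code.
  move=> c d /f_inj cd; apply/funext => s; apply: k_inj.
  exact: (congr1 (@^~ s) cd).
have [b bK] := left_inverse_of_injective (fun=> 0) code_inj.
(* [pmap insub] drops the entries outside [A], hence leaves lists over [A] intact. *)
exists (fun l u => b l (pmap insub u)) => Q /choice[c Qc] _.
exists (code (c \o map val)) => u uA; rewrite bK /=.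
rewrite (pmap_filter (insubK _)) (_ : filter _ u = u) //.
apply/all_filterP/allP => x /uA Ax; rewrite isSome_insub; exact/mem_set.
Qed.

(** * The universal group built from guessed nilpotency bounds *)

Lemma epi_universal_exists (L : choiceType) :
  ~ finite_set [set: L] -> is_weak_power L L L ->
  exists G : groupType, epi_universal L G.
Proof.
move=> infL powL; have [lt [lt_trans lt_total ltL]] := initial_strict_order L.
have /choice[b bP] := fun a => dominating_family infL powL (ltL a).
pose gen (H : groupType) (e : L -> H) (u : seq L) : set H :=
  generated_subgroup (e @` [set` u]).
pose valid (H : groupType) (e : L -> H) (x : L * L) :=
  forall u, (forall y, y \in u -> lt y x.1) ->
    lower_central_series (gen H e (x.1 :: u)) (b x.1 x.2 u) = [set 1].
pose trunc (H : groupType) (e : L -> H) (x : L * L) : H :=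
  if `[< valid H e x >] then e x.1 else 1.
(* Here [e] is any map into any group; the truncation supplies the nilpotency. *)
pose P (H : groupType) (f : L * L -> H) := exists e, f = trunc H e.
exists (residual P); split; first split.
- apply: residual_locally_nilpotent => s.
  (* [below] depends on [s] alone, so the maximum below is the same for all [(H, e)]. *)
  pose below a := [seq y <- unzip1 s | `[< lt y a >]].
  exists (\max_(x <- s) b x.1 x.2 (below x.1)) => H _ [e ->].
  pose v := [seq x <- s | `[< valid H e x >]].
  (* With no valid node in [s], all of [s] evaluates to [1] and the generated subgroup is
     trivial. *)
  have [v0|vN0] := eqVneq (unzip1 v) [::].
    apply: (@lower_central_series_trivial _ _ 0) => //=.
    apply: generated_subgroup_trivial => _ [x /= xs <-]; rewrite /trunc.
    case: asboolP => // xv; suff : x \in v by case: (v) v0.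
    by rewrite mem_filter xs andbT; apply/asboolP.
  have [m mv mmax] := strict_order_max lt_trans lt_total vN0.
  have [[m' l] + /= mE] := mapP mv; rewrite mem_filter -{m'}mE => /andP[/asboolP mlv mls].
  apply: (@lower_central_series_trivial _ _ (b m l (below m))).
    exact: (leq_bigmax_seq (F := fun x => b x.1 x.2 (below x.1))) mls _.
  (* The valid nodes have first component [m] or an element of [below m], so everything lies in the
     subgroup whose class the valid guess [l] bounds. *)
  apply: (lower_central_series_sub_trivial _ _ (mlv (below m) _)).
  + exact: generated_subgroup1.
  + apply: generated_subgroup_min => _ [x /= xs <-]; rewrite /trunc.
    case: asboolP => [xv|_]; last exact: generated_subgroup1.
    apply: sub_gen_smallest; exists x.1 => //=; rewrite inE mem_filter map_f // andbT.
    have /mmax[->|xm] : x.1 \in unzip1 v; last by apply/orP; right; exact/asboolP.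
      by apply: map_f; rewrite mem_filter xs andbT; exact/asboolP.
    by rewrite eqxx.
  + by move=> y; rewrite mem_filter => /andP[/asboolP].
- apply: card_le_trans (weak_power_words infL powL).
  by apply: (surj_card_leT (g := \pi_(residual P)%qT)) => u; exists (repr u); exact: reprK.
move=> H [Hnil /(card_le_surj 1)[e e_surj]].
have Pe : P H (trunc H e) by exists e.
exists (residual_eval Pe) => h _; have [a <-] := e_surj h.
(* The index [l] is a right guess for [a], so the one-letter word on the node [(a, l)] evaluates to
   [e a]. *)
have [u|u w n uw|l lP] := bP a (fun u n => lower_central_series (gen H e (a :: u)) n = [set 1]).
- exact/Hnil/finite_image/finite_seq.
- apply: lower_central_series_sub_trivial; first exact: generated_subgroup1.
  apply: generated_subgroupS; apply: image_subset => x /=.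
  by rewrite !inE => /predU1P[->|/uw ->]; rewrite ?eqxx ?orbT.
exists (\pi_(residual P)%qT [:: ((a, l), true)]) => //.
apply: etrans (residual_eval_pi _ _) _; rewrite /word_eval big_seq1 /= /trunc.
by case: asboolP => // -[].
Qed.

Theorem theorem2p8 (L : Type)
    (infinite_L : ~ finite_set [set: L]%classic)
    (weak_power_L : is_weak_power L L L) :
  exists G : groupType, epi_universal L G.
(* [{classic L}] gives the bare type [L] the choice structure used to form the quotient of words. *)
Proof. exact: (@epi_universal_exists {classic L}). Qed.
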